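(* Let $n\ge 1$, let $A_1,\ldots,A_n\in\mathrm{SL}(2,\mathbb{R})$, let $a>0$, and let $$ E= \left\{ \theta\in[0,2\pi] : \frac{1}{n}\log\|A_nR_\theta\cdots A_1R_\theta\| > -a+\frac1n\sum_{j=1}^n\log\|A_j\| \right\}. $$ Let $\nu$ denote the normalized Lebesgue measure on the circle (i.e. Lebesgue measure on $[0,2\pi]$ divided by $2\pi$). Then $$\nu(E)\ge 1-\frac{\log 2}{a}.$$
   Context: $\mathrm{SL}(2,\mathbb{R})$ is the group of real $2\times 2$ matrices of determinant $1$; $\|\cdot\|$ is the operator norm with respect to the Euclidean norm. For $\theta\in\mathbb{R}$, $R_\theta=\begin{pmatrix}\cos\theta & -\sin\theta\\ \sin\theta & \cos\theta\end{pmatrix}$. The product $A_n R_\theta\cdots A_1R_\theta$ is $(A_nR_\theta)(A_{n-1}R_\theta)\cdots(A_1R_\theta)$. *)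

(* Defs.v *)
From HB Require Import structures.
From mathcomp Require Import all_boot all_order all_algebra.
From mathcomp Require Import all_classical all_reals all_analysis.
Set Implicit Arguments.
Unset Strict Implicit.
Unset Printing Implicit Defensive.
Import Order.TTheory GRing.Theory Num.Theory.
Import numFieldNormedType.Exports.
Local Open Scope classical_set_scope.
Local Open Scope ring_scope.

(* The norm MathComp-Analysis puts on matrices is the max norm, hence the
   explicit Euclidean norm. *)
Definition enorm (R : realType) (m : nat) (v : 'cV[R]_m) : R :=
  Num.sqrt (\sum_i v i ord0 ^+ 2).

Definition opnorm (R : realType) (m : nat) (M : 'M[R]_m) : R :=
  sup [set enorm (M *m v) | v in [set v : 'cV[R]_m | enorm v <= 1]].

Definition rotation (R : realType) (theta : R) : 'M[R]_2 :=
  \matrix_(i, j) if i == j then cos theta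
                 else if (i < j)%N then - sin theta else sin theta.

(* With A_1, ..., A_n stored as A 0, ..., A (n - 1), the reversed index puts
   A_n leftmost: (A_n R_theta) (A_{n-1} R_theta) ... (A_1 R_theta). *)
Definition rotprod (R : realType) (n : nat) (A : 'I_n -> 'M[R]_2) (theta : R) :
    'M[R]_2 :=
  \prod_(i < n) (A (rev_ord i) *m rotation theta).

(* The circle is parametrized by angles in [0, 2 pi]. *)
Definition circle_measure (R : realType) (E : set R) : \bar R :=
  (((2 * pi)^-1)%:E * lebesgue_measure (E `&` `[0%R, (2 * pi)%R]))%E.

(* Main.v *)
Require Import Defs.
From mathcomp Require Import all_boot all_order all_algebra.
From mathcomp Require Import all_classical all_reals all_analysis.
From mathcomp Require Import ring lra.
From mathcomp Require complex.
Import Order.TTheory GRing.Theory Num.Theory.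
Import numFieldNormedType.Exports.
Local Open Scope classical_set_scope.
Local Open Scope ring_scope.

Import complex.

Set Implicit Arguments.
Unset Strict Implicit.
Unset Printing Implicit Defensive.

Local Notation normc := ComplexField.Normc.normc.

(* In the eigenbasis of the rotations, A_j R_theta becomes, up to the unit scalar
   e^{i theta}, the product of a constant matrix and diag(z^2, 1), where
   z = e^{i theta}.  The lower right entry of the whole product is therefore a
   polynomial p in z.  On the circle |p| <= ||A_n R_theta ... A_1 R_theta||
   <= prod ||A_j||, and p(0) is the product of the lower right entries of the
   factors, each of modulus at least ||A_j|| / 2; hence log (prod ||A_j|| / |p|)
   is nonnegative with mean at most n log 2 by Jensen's inequality, and Markov's
   inequality concludes.

   Jensen's inequality is replaced by a discrete version that needs no integral
   of log |p|: the polynomial prod_k p(w^k z), with w a primitive N-th root of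
   unity, has value p(0)^N at 0, so its modulus is at least |p(0)|^N somewhere on
   the circle.  This bounds the number of points of some N-point grid where |p|
   is small, and then, p being Lipschitz on the circle, the outer measure of the
   set where |p| is small. *)

(** * Roots of unity and a discrete Jensen inequality *)

Section UnitCircle.
Variable R : realType.
Implicit Types (s t : R) (z : R[i]) (p : {poly R[i]}).

(** Discrete mean value property: for 0 < i < n the powers of [z ^+ i] form a geometric sum, which
    vanishes since [z ^+ i] is an n-th root of unity other than 1. Only the constant term
    survives. *)
Lemma sum_prim_root (F : fieldType) (n : nat) (z : F) (p : {poly F}) :
  n.-primitive_root z -> (size p <= n)%N ->
  \sum_(m < n) p.[z ^+ m] = p.[0] *+ n.
Proof.
move=> zP szp; have n0 := prim_order_gt0 zP.
under eq_bigr do rewrite (horner_coef_wide _ szp).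
rewrite exchange_big /= (bigD1 (Ordinal n0)) //= [X in _ + X]big1 ?addr0.
  under eq_bigr do rewrite expr0 mulr1.
  by rewrite sumr_const card_ord horner_coef0.
move=> i i0; rewrite -mulr_sumr.
have /negPf zi1 : z ^+ i != 1.
  by rewrite -(prim_order_dvd zP) /dvdn modn_small//.
have := subrX1 (z ^+ i) n.
rewrite -exprM mulnC exprM (prim_expr_order zP) expr1n subrr.
move/esym/eqP; rewrite mulf_eq0 subr_eq0 zi1 /= => /eqP.
under eq_bigr do rewrite -exprM mulnC exprM.
by move=> ->; rewrite mulr0.
Qed.

Definition cis t : R[i] := Complex (cos t) (sin t).

Lemma cisD s t : cis (s + t) = cis s * cis t.
Proof. by rewrite /cis cosD sinD /GRing.mul /= [X in Complex _ X]addrC. Qed.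

Lemma cis0 : cis 0 = 1.
Proof. by rewrite /cis cos0 sin0. Qed.

Lemma cisMn t (n : nat) : cis (t *+ n) = cis t ^+ n.
Proof. by elim: n => [|n IH]; rewrite ?cis0 // mulrS exprS cisD IH. Qed.

Lemma normc_cis t : normc (cis t) = 1.
Proof. by rewrite /= cos2Dsin2 sqrtr1. Qed.

Lemma periodic_cis : periodic cis (pi *+ 2).
Proof. by move=> t; rewrite /cis cosD2pi sinD2pi. Qed.

Lemma cis_prim_root (n : nat) : (0 < n)%N ->
  n.-primitive_root (cis (pi *+ 2 / n%:R)).
Proof.
move=> n0; apply/andP; split=> //; apply/forallP => i; apply/eqP.
rewrite unity_rootE -cisMn.
have nR0 : 0 < n%:R :> R by rewrite ltr0n.
have [->|ni] := eqVneq i.+1 n.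
  rewrite -[_ / _ *+ _]mulr_natr divfK ?(gt_eqF nR0)// -[pi *+ 2]add0r.
  by rewrite periodic_cis cis0 eqxx.
(* With x = pi (i + 1) / n, the angle is 2 x and cos (2 x) = 1 - 2 sin^2 x, so the value 1 would
   force sin x = 0, although 0 < x < pi. *)
apply/negbTE/eqP => -[] c1 _; move: c1.
rewrite [X in cos X](_ : _ = (pi * i.+1%:R / n%:R) *+ 2); last first.
  rewrite -[LHS]mulr_natr -[pi *+ 2]mulr_natr -[RHS]mulr_natr.
  by rewrite mulrAC [_ * 2 * _]mulrAC [_ * 2 * _]mulrAC.
rewrite cos_mulr2n cos2sin2 => c1.
have s0 : sin (pi * i.+1%:R / n%:R) = 0 :> R.
  by apply/eqP; rewrite -sqrf_eq0; apply/eqP; lra.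
have := @sin_gt0_pi R (pi * i.+1%:R / n%:R); rewrite s0 ltxx => /(_ _)/negP.
apply; last by [].
rewrite divr_gt0 ?mulr_gt0 ?pi_gt0 ?ltr0Sn//=.
rewrite ltr_pdivrMr// ltr_pM2l ?pi_gt0// ltr_nat ltn_neqAle ni.
by have := ltn_ord i.
Qed.

Lemma normc_ge0 z : 0 <= normc z.
Proof. by case: z => x y; rewrite sqrtr_ge0. Qed.

Lemma normcX z (n : nat) : normc (z ^+ n) = normc z ^+ n.
Proof.
elim: n => [|n IH]; first by rewrite !expr0 ComplexField.Normc.normc1.
by rewrite !exprS ComplexField.Normc.normcM IH.
Qed.

Lemma normc_prod (I : Type) (r : seq I) (F : I -> R[i]) :
  normc (\prod_(i <- r) F i) = \prod_(i <- r) normc (F i).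
Proof.
elim/big_rec2: _ => [|i x y _ <-]; first exact: ComplexField.Normc.normc1.
exact: ComplexField.Normc.normcM.
Qed.

Lemma normc_sum (I : Type) (r : seq I) (F : I -> R[i]) :
  normc (\sum_(i <- r) F i) <= \sum_(i <- r) normc (F i).
Proof.
elim/big_ind2: _ => //; first by rewrite ComplexField.Normc.normc0.
by move=> x a y b xa yb; rewrite (le_trans (le_normcD _ _))// lerD.
Qed.

(** Maximum principle on a finite grid: [p.[0]] is the mean of the values at the roots of unity, so
    they cannot all have smaller modulus. *)
Lemma normc_poly0_le_prim_root p (n : nat) : (0 < n)%N -> (size p <= n)%N ->
  exists m : 'I_n, normc p.[0] <= normc p.[cis (pi *+ 2 / n%:R *+ m)].
Proof.
move=> n0 szp; apply/existsP; apply: contraT; rewrite negb_exists => /forallP h.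
have : normc (p.[0] *+ n) < normc p.[0] *+ n.
  rewrite -(sum_prim_root (cis_prim_root n0) szp).
  apply: (le_lt_trans (normc_sum _ _)).
  rewrite -[in X in _ < X](card_ord n) -sumr_const; apply: ltr_sum.
    by apply/hasP; exists (Ordinal n0); rewrite ?mem_index_enum.
  by move=> m _; rewrite -cisMn ltNge h.
by rewrite normcMn ltxx.
Qed.

(** Moving the grid by one of its own steps permutes its points cyclically modulo the period. *)
Lemma cyclic_prod_shift (f : R -> R) (T : R) (n q : nat) t : (0 < n)%N ->
  periodic f T ->
  \prod_(k < n) f (t + T / n%:R *+ q + T / n%:R *+ k) =
  \prod_(k < n) f (t + T / n%:R *+ k).
Proof.
move=> n0 fT; elim: q t => [|q IH] t; first by rewrite addr0.
rewrite mulrS [t + (_ + _)]addrA IH; case: n n0 => // n _ in IH *.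
rewrite big_ord_recr [RHS]big_ord_recl /= mulrC; congr (_ * _).
  by rewrite -addrA -mulrS -[_ *+ n.+1]mulr_natr divfK// fT addr0.
apply: eq_bigr => k _; rewrite /bump /= add1n.
by rewrite -addrA -mulrS.
Qed.

(* The maximum principle at 0 for the product of the rotated copies of [p]. *)
Lemma jensen_grid p (n : nat) : (0 < n)%N ->
  exists t, 0 <= t <= pi *+ 2 / n%:R /\
    normc p.[0] ^+ n <= \prod_(k < n) normc p.[cis (t + pi *+ 2 / n%:R *+ k)].
Proof.
move=> n0.
pose P := \prod_(k < n) (p \Po (cis (pi *+ 2 / n%:R *+ k) *: 'X)).
have PE s : normc P.[cis s] = \prod_(k < n) normc p.[cis (s + pi *+ 2 / n%:R *+ k)].
  rewrite horner_prod normc_prod; apply: eq_bigr => k _.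
  by rewrite horner_comp hornerZ hornerX -cisD addrC.
have P0 : P.[0] = p.[0] ^+ n.
  rewrite horner_prod -[in RHS](card_ord n) -prodr_const.
  by apply: eq_bigr => k _; rewrite horner_comp hornerZ hornerX mulr0.
(* The grid of [d * n] points is fine enough for the maximum principle applied to [P], and it
   refines the grid of [n] points. *)
pose d := (size P).+1.
have dn0 : (0 < d * n)%N by rewrite muln_gt0.
have szP : (size P <= d * n)%N by rewrite (leq_trans (leqnSn _))// leq_pmulr.
have [m] := normc_poly0_le_prim_root dn0 szP.
rewrite P0 normcX PE => le_m.
set h := pi *+ 2 / (d * n)%:R in le_m.
have h0 : 0 <= h by rewrite divr_ge0// mulrn_wge0 ?pi_ge0.
have hE : pi *+ 2 / n%:R = h *+ d.
  by rewrite /h natrM invfM mulrA mulrAC -[RHS]mulr_natr divfK// pnatr_eq0.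
(* The multiple of [d] in [m] amounts to whole steps of the coarse grid, which leave the product
   unchanged; the remainder is an offset within one coarse step. *)
exists (h *+ (m %% d)%N); split.
  by rewrite mulrn_wge0//= hE ler_wpMn2l// ltnW// ltn_mod.
apply: (le_trans le_m); rewrite {1}(divn_eq m d) addnC mulrnDr.
rewrite [(m %/ d * d)%N]mulnC mulrnA -hE.
rewrite (@cyclic_prod_shift (fun t => normc p.[cis t]))//.
by move=> t /=; rewrite periodic_cis.
Qed.

End UnitCircle.

(** * The operator norm and the conformal part of a real 2x2 matrix *)

Section OperatorNorm.
Variable R : realType.
Implicit Types (M N : 'M[R]_2) (v : 'cV[R]_2).

Lemma enorm_ge0 m (v : 'cV[R]_m) : 0 <= enorm v.
Proof. exact: sqrtr_ge0. Qed.

Lemma enormZ m (c : R) (v : 'cV[R]_m) : enorm (c *: v) = `|c| * enorm v.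
Proof.
rewrite /enorm -sqrtr_sqr -sqrtrM ?sqr_ge0// mulr_sumr.
by congr Num.sqrt; apply: eq_bigr => i _; rewrite mxE exprMn.
Qed.

Lemma lift00 : lift ord0 ord0 = 1 :> 'I_2.
Proof. exact/val_inj. Qed.

Lemma sqr_enorm v : enorm v ^+ 2 = v 0 0 ^+ 2 + v 1 0 ^+ 2.
Proof.
rewrite sqr_sqrtr; last by apply: sumr_ge0 => i _; rewrite sqr_ge0.
by rewrite !big_ord_recl big_ord0 addr0 lift00.
Qed.

Lemma mulmx2E (S : pzSemiRingType) m n (M : 'M[S]_(m, 2)) (N : 'M[S]_(2, n)) i j :
  (M *m N) i j = M i 0 * N 0 j + M i 1 * N 1 j.
Proof. by rewrite mxE !big_ord_recl big_ord0 addr0 lift00. Qed.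

Definition sqr_frob M := M 0 0 ^+ 2 + M 0 1 ^+ 2 + M 1 0 ^+ 2 + M 1 1 ^+ 2.

Lemma sqr_frob_ge0 M : 0 <= sqr_frob M.
Proof. by rewrite !addr_ge0// sqr_ge0. Qed.

(** Cauchy-Schwarz, by Lagrange's identity on each row. It bounds above the set whose [sup] is
    [opnorm], so that this supremum is a genuine one. *)
Lemma enorm_mulmx_frob M v : enorm (M *m v) <= Num.sqrt (sqr_frob M) * enorm v.
Proof.
rewrite -ler_sqr ?nnegrE ?mulr_ge0 ?sqrtr_ge0//.
rewrite exprMn (sqr_sqrtr (sqr_frob_ge0 M)) !sqr_enorm !mulmx2E /sqr_frob.
set a := M 0 0; set b := M 0 1; set c := M 1 0; set d := M 1 1.
set x := v 0 0; set y := v 1 0.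
rewrite -subr_ge0 [leRHS](_ : _ = (a * y - b * x) ^+ 2 + (c * y - d * x) ^+ 2).
  by rewrite addr_ge0 ?sqr_ge0.
by ring.
Qed.

Lemma opnorm_le M (c : R) :
  (forall v, enorm v <= 1 -> enorm (M *m v) <= c) -> opnorm M <= c.
Proof.
move=> h; apply: ge_sup; last by move=> _ [v /= v1 <-]; exact: h.
exists (enorm (M *m 0)); exists 0 => //=.
by rewrite -(scale0r 0) enormZ normr0 mul0r ler01.
Qed.

Lemma enorm_le_opnorm M v : enorm v <= 1 -> enorm (M *m v) <= opnorm M.
Proof.
move=> v1; apply: ub_le_sup; last by exists v.
exists (Num.sqrt (sqr_frob M)) => _ [w /= w1 <-].
by rewrite (le_trans (enorm_mulmx_frob _ _))// ler_piMr ?sqrtr_ge0.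
Qed.

Lemma enorm_mulmx M v : enorm (M *m v) <= opnorm M * enorm v.
Proof.
have [v0|v0] := eqVneq (enorm v) 0.
  by rewrite (le_trans (enorm_mulmx_frob _ _))// v0 !mulr0.
have v_gt0 : 0 < enorm v by rewrite lt_def v0 enorm_ge0.
have := @enorm_le_opnorm M ((enorm v)^-1 *: v).
rewrite -scalemxAr !enormZ ger0_norm ?invr_ge0 ?enorm_ge0// mulVf//.
by move=> /(_ (lexx _)); rewrite mulrC ler_pdivrMr.
Qed.

Lemma opnorm_ge0 M : 0 <= opnorm M.
Proof.
apply: le_trans (enorm_ge0 (M *m 0)) _; apply: enorm_le_opnorm.
by rewrite -(scale0r 0) enormZ normr0 mul0r ler01.
Qed.

Lemma opnormM M N : opnorm (M *m N) <= opnorm M * opnorm N.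
Proof.
apply: opnorm_le => v v1; rewrite -mulmxA (le_trans (enorm_mulmx _ _))//.
by rewrite ler_wpM2l ?opnorm_ge0// enorm_le_opnorm.
Qed.

Lemma opnorm1_le1 : opnorm (1 : 'M[R]_2) <= 1.
Proof. by apply: opnorm_le => v; rewrite mul1mx. Qed.

Lemma opnorm_rotation_le1 t : opnorm (rotation t : 'M[R]_2) <= 1.
Proof.
apply: opnorm_le => v; apply: le_trans.
rewrite -ler_sqr ?nnegrE ?enorm_ge0// !sqr_enorm !mulmx2E !mxE /=.
have := cos2Dsin2 t; set x := v 0 0; set y := v 1 0 => cs.
rewrite -[leRHS]mul1r -cs le_eqVlt; apply/orP; left; apply/eqP; ring.
Qed.

Lemma opnorm_rotprod_le n (A : 'I_n -> 'M[R]_2) t :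
  opnorm (rotprod A t) <= \prod_(j < n) opnorm (A j).
Proof.
rewrite [leRHS](reindex_inj rev_ord_inj) /=.
rewrite /rotprod; elim/big_ind2: _ => [|M x N y Mx Ny|i _].
- exact: opnorm1_le1.
- by rewrite (le_trans (opnormM _ _))// ler_pM ?opnorm_ge0.
- by rewrite (le_trans (opnormM _ _))// ler_piMr ?opnorm_ge0 ?opnorm_rotation_le1.
Qed.

Lemma det2E (S : comPzRingType) (M : 'M[S]_2) : \det M = M 0 0 * M 1 1 - M 0 1 * M 1 0.
Proof.
rewrite (expand_det_row _ 0) !big_ord_recl big_ord0 addr0 lift00.
rewrite /cofactor !det_mx11 !mxE /= expr0 mul1r expr1.
rewrite mulN1r mulrN; congr (_ * M _ _ - _ * M _ _); exact/val_inj.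
Qed.

(* A real 2x2 matrix acts on the plane C as z |-> u z + v (conj z); this is the
   conjugate of u. *)
Definition conformal M : R[i] :=
  Complex ((M 0 0 + M 1 1) / 2) ((M 0 1 - M 1 0) / 2).

Lemma sqr_normc (z : R[i]) : normc z ^+ 2 = Re z ^+ 2 + Im z ^+ 2.
Proof. by case: z => x y; rewrite /= sqr_sqrtr// addr_ge0 ?sqr_ge0. Qed.

Lemma sqr_col_le_opnorm M (j : 'I_2) : M 0 j ^+ 2 + M 1 j ^+ 2 <= opnorm M ^+ 2.
Proof.
have e1 : enorm (delta_mx j 0 : 'cV[R]_2) ^+ 2 = 1.
  by rewrite sqr_enorm !mxE; case: j => -[|[|]]//= ?; rewrite expr1n expr0n ?addr0 ?add0r.
have := @enorm_le_opnorm M (delta_mx j 0).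
rewrite -ler_sqr ?nnegrE ?enorm_ge0// e1 expr1n lexx => /(_ isT).
by rewrite -ler_sqr ?nnegrE ?enorm_ge0 ?opnorm_ge0// -colE sqr_enorm !mxE.
Qed.

(** The squared modulus is at most half the squared Frobenius norm, that is, the mean of the squared
    norms of the two columns, each at most [opnorm M ^+ 2]. *)
Lemma normc_conformal_le M : normc (conformal M) <= opnorm M.
Proof.
rewrite -ler_sqr ?nnegrE ?opnorm_ge0 ?sqrtr_ge0// sqr_normc /=.
have := sqr_col_le_opnorm M 0; have := sqr_col_le_opnorm M 1.
set s := opnorm M ^+ 2; set a := M 0 0; set b := M 0 1; set c := M 1 0.
set d := M 1 1 => h1 h2.
have h3 := sqr_ge0 (a - d); have h4 := sqr_ge0 (b + c).
suff : ((a + d) / 2) ^+ 2 + ((b - c) / 2) ^+ 2 =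
  (a ^+ 2 + c ^+ 2 + (b ^+ 2 + d ^+ 2)) / 2
   - ((a - d) ^+ 2 + (b + c) ^+ 2) / 4 by move=> ->; lra.
by field.
Qed.

(** The operator norm is at most the Frobenius norm, and 4 |conformal M|^2 = [sqr_frob M] + 2 det
    M. *)
Lemma opnorm_le_conformal M : \det M = 1 -> opnorm M / 2 <= normc (conformal M).
Proof.
rewrite det2E => d1; rewrite ler_pdivrMr//.
apply: (@le_trans _ _ (Num.sqrt (sqr_frob M))).
  apply: opnorm_le => v v1.
  by rewrite (le_trans (enorm_mulmx_frob _ _))// ler_piMr ?sqrtr_ge0.
rewrite -ler_sqr ?nnegrE ?mulr_ge0 ?sqrtr_ge0// exprMn sqr_normc.
rewrite sqr_sqrtr ?sqr_frob_ge0//= /sqr_frob.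
rewrite [leRHS](_ : _ = M 0 0 ^+ 2 + M 0 1 ^+ 2 + M 1 0 ^+ 2 + M 1 1 ^+ 2
  + 2 * (M 0 0 * M 1 1 - M 0 1 * M 1 0)); last by field.
by rewrite d1 lerDl.
Qed.

Lemma opnorm_gt0 M : \det M = 1 -> 0 < opnorm M.
Proof.
move=> d1; rewrite lt_def opnorm_ge0 andbT; apply/eqP => M0.
have := sqr_col_le_opnorm M 0; have := sqr_col_le_opnorm M 1.
move: d1; rewrite det2E M0 => d1.
rewrite expr0n /= => h1 h2.
suff : M 0 1 = 0 /\ M 1 1 = 0.
  by move=> [b0 c0]; move: d1; rewrite b0 c0; lra.
have := sqr_ge0 (M 0 1); have := sqr_ge0 (M 1 1).
by split; apply/eqP; rewrite -sqrf_eq0; apply/eqP; lra.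
Qed.

End OperatorNorm.

(** * The matrix product as a polynomial in e^{i theta} *)

Section ProductPolynomial.
Variable R : realType.
Local Notation C := R[i].
Local Notation toC := (map_mx (real_complex R)).

(* The columns of [rot_basis] are the eigenvectors (1, -i) and (1, i) of every
   rotation, for the eigenvalues cis t and cis (- t). *)
Definition rot_basis : 'M[C]_2 :=
  \matrix_(i, j) if i == 0 then 1 else if j == 0 then - 'i%C else 'i%C.

Definition rot_basis_inv : 'M[C]_2 :=
  \matrix_(i, j) ((2^-1)%:C%C * if j == 0 then 1 else if i == 0 then 'i%C else - 'i%C).

Definition in_rot_basis (M : 'M[R]_2) : 'M[C]_2 :=
  rot_basis_inv *m toC M *m rot_basis.

Definition diag2 (S : pzSemiRingType) (x y : S) : 'M[S]_2 :=
  \matrix_(i, j) if i == j then if i == 0 then x else y else 0.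

Lemma ord2P (P : 'I_2 -> Prop) : P 0 -> P 1 -> forall i, P i.
Proof.
move=> P0 P1 [[|[|//]] i2]; [move: P0|move: P1]; congr P; exact/val_inj.
Qed.

Lemma mx2P (S : Type) (M N : 'M[S]_2) :
  M 0 0 = N 0 0 -> M 0 1 = N 0 1 -> M 1 0 = N 1 0 -> M 1 1 = N 1 1 -> M = N.
Proof.
by move=> h00 h01 h10 h11; apply/matrixP => i j; elim/ord2P: i; elim/ord2P: j.
Qed.

Lemma rot_basisK : rot_basis *m rot_basis_inv = 1.
Proof.
by apply: mx2P; rewrite mulmx2E !mxE /=; apply/eqP; rewrite eq_complex /=;
  apply/andP; split; apply/eqP; field.
Qed.

Lemma in_rot_basis1 : in_rot_basis 1 = 1.
Proof. by rewrite /in_rot_basis map_mx1 mulmx1 (mulmx1C rot_basisK). Qed.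

Lemma in_rot_basisM (M N : 'M[R]_2) :
  in_rot_basis (M *m N) = in_rot_basis M *m in_rot_basis N.
Proof.
rewrite /in_rot_basis map_mxM -!mulmxA; do 2 congr (_ *m _).
by rewrite (mulmxA rot_basis) rot_basisK mul1mx.
Qed.

Lemma in_rot_basis11 (M : 'M[R]_2) : in_rot_basis M 1 1 = conformal M.
Proof.
rewrite !mulmx2E !mxE /=; apply/eqP; rewrite eq_complex /=.
by apply/andP; split; apply/eqP; field.
Qed.

(** The scalar [cis t] turns the eigenvalues [cis t] and [cis (- t)] into [cis t ^+ 2] and 1,
    removing the negative power. *)
Lemma in_rot_basis_rotation (t : R) :
  cis t *: in_rot_basis (rotation t) = diag2 (cis t ^+ 2) 1.
Proof.
have cs := sin2cos2 t.
by apply: mx2P; rewrite mxE /in_rot_basis !mulmx2E !mxE /=;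
  apply/eqP; rewrite eq_complex /=;
  apply/andP; split; apply/eqP; field: cs.
Qed.

Lemma rotprod_poly (n : nat) (A : 'I_n -> 'M[R]_2) : exists p : {poly C},
  normc p.[0] = \prod_(j < n) normc (conformal (A j)) /\
  forall t, normc p.[cis t] = normc (conformal (rotprod A t)).
Proof.
pose T j : 'M[{poly C}]_2 := map_mx polyC (in_rot_basis (A j)) *m diag2 'X^2 1.
pose P := \prod_(i < n) T (rev_ord i).
exists (P 1 1); split.
  rewrite [RHS](reindex_inj rev_ord_inj) /=.
  (* At 0 the factor [diag2 'X^2 1] kills the first column of each [T j]. The matrices are then
     upper triangular, and their lower right entries multiply. *)
  pose K (Q : 'M[{poly C}]_2) (y : R) := (Q 1 0).[0] = 0 /\ normc (Q 1 1).[0] = y.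
  suff [] : K P (\prod_(i < n) normc (conformal (A (rev_ord i)))) by [].
  rewrite /P; elim/big_ind2: _ => [|Q x Q' y [Q0 Q1] [Q'0 Q'1]|i _]; split.
  - by rewrite !mxE /= horner0.
  - by rewrite !mxE /= hornerC ComplexField.Normc.normc1.
  - by rewrite mulmx2E !hornerE Q0 Q'0 mul0r mulr0 addr0.
  - by rewrite mulmx2E !hornerE Q0 mul0r add0r ComplexField.Normc.normcM Q1 Q'1.
  - by rewrite mulmx2E !mxE !hornerE /= !mulr0.
  - rewrite mulmx2E !hornerE -in_rot_basis11.
    by rewrite ![(map_mx _ _) _ _]mxE ![diag2 _ _ _ _]mxE !hornerE.
move=> t.
(* On the circle the polynomial matrix is the real one in the eigenbasis, up to a unit scalar that
   gains one [cis t] per factor. *)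
pose K (Q : 'M[{poly C}]_2) (M : 'M[R]_2) :=
  exists2 c, normc c = 1 & map_mx (horner_eval (cis t)) Q = c *: in_rot_basis M.
suff [c c1 /matrixP/(_ 1 1)] : K P (rotprod A t).
  rewrite [LHS]mxE [RHS]mxE /horner_eval => ->.
  by rewrite ComplexField.Normc.normcM c1 mul1r in_rot_basis11.
rewrite /P /rotprod; elim/big_ind2: _ => [|Q M Q' M' [c c1 cQ] [c' c1' cQ']|i _].
- by exists 1; rewrite ?ComplexField.Normc.normc1// in_rot_basis1 scale1r rmorph1.
- exists (c * c'); first by rewrite ComplexField.Normc.normcM c1 c1' mulr1.
  by rewrite map_mxM cQ cQ' in_rot_basisM -scalemxAl -scalemxAr scalerA.
- exists (cis t); first exact: normc_cis.
  rewrite in_rot_basisM scalemxAr in_rot_basis_rotation map_mxM; congr (_ *m _).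
    by apply/matrixP => k l; rewrite 2!mxE; exact: hornerC.
  apply/matrixP => k l; rewrite 2!mxE [RHS]mxE.
  by do 2?case: ifP => _; rewrite /= /horner_eval !hornerE.
Qed.

End ProductPolynomial.

(** * From grid counts to Lebesgue measure *)

Section JensenMeasure.
Variable R : realType.
Implicit Types (p : {poly R[i]}) (E F X : set R).

Lemma lebesgue_le_cover (n : nat) X E (F : nat -> set R) :
  X `<=` E `|` \big[setU/set0]_(k < n) F k ->
  (lebesgue_measure X <= lebesgue_measure E
     + \sum_(k < n) lebesgue_measure (F k))%E.
Proof.
pose mu := mu_ext (@wlength R idfun) : {outer_measure set (ocitv_type R) -> \bar R}.
(* Unfolded, [lebesgue_measure] is the outer measure generated by interval length, which is
   subadditive on arbitrary sets. *)
move=> XEF; change (mu X <= mu E + \sum_(k < n) mu (F k))%E.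
apply: (le_trans (le_outer_measure mu _ _ XEF)).
apply: (le_trans (outer_measureU2 _ _ _)).
by rewrite leeD2l// outer_measure_subadditive.
Qed.

(** The sup bound and the Lipschitz bound go through the induction together, because the increment
    of a product p(z) z involves both. *)
Lemma poly_lipschitz p : exists K : R, forall z w, normc z = 1 -> normc w = 1 ->
  normc p.[z] <= K /\ normc (p.[z] - p.[w]) <= K * normc (z - w).
Proof.
elim/poly_ind: p => [|p c [K hK]].
  exists 0 => z w _ _; rewrite !horner0 subr0 mul0r.
  by rewrite ComplexField.Normc.normc0.
exists (2 * K + normc c) => z w z1 w1.
have [pz pzw] := hK z w z1 w1; have [pw _] := hK w z w1 z1.
have K0 : 0 <= K := le_trans (normc_ge0 _) pz.
have c0 := normc_ge0 c; have zw0 := normc_ge0 (z - w).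
rewrite !hornerMXaddC; split.
  rewrite (le_trans (le_normcD _ _))// lerD2r ComplexField.Normc.normcM z1 mulr1.
  by lra.
rewrite [p.[z] * z + c - _](_ : _ = (p.[z] - p.[w]) * z + p.[w] * (z - w)); last by ring.
rewrite (le_trans (le_normcD _ _))// !ComplexField.Normc.normcM z1 mulr1.
have : normc p.[w] * normc (z - w) <= K * normc (z - w) by rewrite ler_wpM2r.
have : 0 <= normc c * normc (z - w) by rewrite mulr_ge0.
lra.
Qed.

Lemma cos_sin_lipschitz (s t : R) :
  `|cos s - cos t| <= `|s - t| /\ `|sin s - sin t| <= `|s - t|.
Proof.
have MVT_le (f df : R -> R) : (forall x : R, is_derive x 1 f (df x)) ->
    (forall x, `|df x| <= 1) -> `|f s - f t| <= `|s - t|.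
  move=> fE df1; wlog st : s t / s <= t.
    move=> H; have [|/ltW] := leP s t; first exact: H.
    by move=> ts; rewrite distrC [leRHS]distrC; exact: H.
  have [|c _] := @MVT_segment R f df s t st (fun x _ => fE x).
    apply: continuous_subspaceT => x; apply/differentiable_continuous.
    by apply/derivable1_diffP; have [] := fE x.
  by rewrite distrC [leRHS]distrC => ->; rewrite normrM ler_piMl.
split.
- apply: (MVT_le _ (fun x => - sin x)) => x.
  by rewrite normrN ler_norml sin_geN1 sin_le1.
- by apply: (MVT_le _ cos) => x; rewrite ler_norml cos_geN1 cos_le1.
Qed.

Lemma normc_le_abs (z : R[i]) : normc z <= `|Re z| + `|Im z|.
Proof.
case: z => x y /=.
rewrite -[leRHS]ger0_norm ?addr_ge0// -sqrtr_sqr ler_wsqrtr//.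
by rewrite sqrrD !real_normK ?num_real// addrAC lerDl mulrn_wge0// mulr_ge0.
Qed.

Lemma poly_cis_lipschitz p : exists2 K : R, 0 <= K &
  forall s t, normc p.[cis s] <= normc p.[cis t] + K * `|s - t|.
Proof.
have [K hK] := poly_lipschitz p.
have K0 : 0 <= K.
  by have [/(le_trans (normc_ge0 _))] := hK _ _ (normc_cis 0) (normc_cis 0).
(* The factor 2 comes from bounding the modulus by the real plus the imaginary part, with [cos] and
   [sin] both 1-Lipschitz. *)
exists (K * 2) => [|s t]; first by rewrite mulr_ge0.
have [_ pst] := hK _ _ (normc_cis s) (normc_cis t).
rewrite -[p.[cis s]](subrKC p.[cis t]) (le_trans (le_normcD _ _))// lerD2l.
rewrite (le_trans pst)// -mulrA ler_wpM2l// (le_trans (normc_le_abs _))//=.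
by have [] := cos_sin_lipschitz s t; lra.
Qed.

(** Markov's inequality on the grid: with b small values, the product of the moduli is at most M^n
    e^{-b u}, while [jensen_grid] makes it at least M^n e^{-n s} for a suitable [t]. *)
Lemma jensen_grid_count p (M s u : R) (n : nat) : (0 < n)%N -> 0 < M ->
  (forall t, normc p.[cis t] <= M) -> M * expR (- s) <= normc p.[0] ->
  exists t, 0 <= t <= pi *+ 2 / n%:R /\
    (\sum_(k < n) (normc p.[cis (t + pi *+ 2 / n%:R *+ k)] <= M * expR (- u))%R)%N%:R * u
      <= n%:R * s.
Proof.
move=> n0 M0 pM sp; have [t [t0 tn]] := jensen_grid p n0; exists t; split => //.
set b := (\sum_(k < n) _)%N.
have : (M * expR (- s)) ^+ n <= M ^+ n * expR (- u) ^+ b.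
  apply: le_trans (le_trans _ tn) _.
    by rewrite lerXn2r ?nnegrE ?normc_ge0// mulr_ge0 ?expR_ge0// ltW.
  rewrite -[in M ^+ n](card_ord n) -prodr_const expr_sum -big_split /=.
  apply: ler_prod => k _; rewrite normc_ge0/=.
  by case: (boolP (_ <= M * expR (- u))) => [|_]; rewrite ?expr1 ?expr0 ?mulr1.
rewrite exprMn ler_pM2l ?exprn_gt0// -!expRM_natl ler_expR; lra.
Qed.

Lemma cells_cover (h : R) (n : nat) (t : R) : 0 < h -> (0 < n)%N ->
  0 <= t <= h *+ n -> exists2 k, (k < n)%N & h *+ k <= t <= h *+ k.+1.
Proof.
move=> h0 n0 /andP[t0]; rewrite le_eqVlt => /orP[/eqP ->|tn].
  (* The right endpoint would be assigned by truncation to a cell number [n], so it goes to the last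
     cell instead. *)
  by exists n.-1; rewrite ?prednK// lexx ler_wpMn2l ?leq_pred// ltW.
have /truncn_itv/andP[kt tk] : 0 <= t / h by rewrite divr_ge0// ltW.
exists (Num.truncn (t / h)).
  by rewrite -(ltr_nat R) (le_lt_trans kt)// ltr_pdivrMr// mulr_natl.
by rewrite -![h *+ _]mulr_natl -ler_pdivlMr// kt -ler_pdivrMr// ltW.
Qed.

(** Cut the circle into [n] cells, each containing one grid point. If [E] misses a point of a cell,
    |p| is small there, hence by the Lipschitz bound nearly as small at the grid point. The cells
    with a small grid value thus cover what [E] misses, and [jensen_grid_count] bounds their
    number. *)
Lemma jensen_measure p (M s u : R) E : 0 < M -> 0 <= s -> 0 < u ->
  (forall t, normc p.[cis t] <= M) -> M * expR (- s) <= normc p.[0] ->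
  (forall t, t \in `[0, pi *+ 2] -> M * expR (- u) < normc p.[cis t] -> E t) ->
  ((pi *+ 2 * (1 - s / u))%:E <= lebesgue_measure E)%E.
Proof.
move=> M0 s0 u0 pM sp EP; apply/lee_addgt0Pr => e e0.
have pi2 : 0 < pi *+ 2 :> R by rewrite mulrn_wgt0// pi_gt0.
have [u' /andP[u'0 u'u] u'e] : exists2 u', 0 < u' < u &
    pi *+ 2 * (s / u') <= pi *+ 2 * (s / u) + e.
  (* With u' = u / (1 + d) the excess is exactly e s / (s + 1) <= e; the denominator s + 1 keeps [d]
     defined when s = 0. *)
  pose d := e * u / (pi *+ 2 * (s + 1)).
  have s1 : 0 < s + 1 by rewrite ltr_wpDl.
  have d0 : 0 < d by rewrite divr_gt0 ?mulr_gt0.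
  exists (u / (1 + d)).
    by rewrite divr_gt0 ?addr_gt0//= ltr_pdivrMr ?addr_gt0// ltr_pMr// ltrDl.
  rewrite [leLHS](_ : _ = pi *+ 2 * (s / u) + e * (s / (s + 1))); last first.
    rewrite /d; move: (pi *+ 2) pi2 => T T0.
    by field; rewrite !gt_eqF//= addr_gt0// mulr_gt0.
  by rewrite lerD2l ler_piMr ?(ltW e0)// ler_pdivrMr// mul1r lerDl.
have [K K0 pK] := poly_cis_lipschitz p.
(* The gap between the two thresholds absorbs the variation of |p| across one cell, once [n] is so
   large that K h < g. *)
pose g := M * expR (- u') - M * expR (- u).
have g0 : 0 < g by rewrite subr_gt0 ltr_pM2l// ltr_expR ltrN2.
have Kg : 0 <= K * (pi *+ 2) / g by rewrite divr_ge0 ?mulr_ge0 ?(ltW g0) ?(ltW pi2).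
have [n nK] : exists n : nat, K * (pi *+ 2) / g < n%:R.
  by exists (Num.bound (K * (pi *+ 2) / g)); exact: archi_boundP.
have nR0 := le_lt_trans Kg nK.
have n0 : (0 < n)%N by rewrite -(ltr_nat R).
have [t [/andP[t0 th]]] := jensen_grid_count u' n0 M0 pM sp.
set h := pi *+ 2 / n%:R in th *.
pose bad k := normc p.[cis (t + h *+ k)] <= M * expR (- u').
rewrite -[(\sum_(k < n) _)%N]/(\sum_(k < n) bad k)%N => count.
have h0 : 0 < h by rewrite divr_gt0.
have hn : h *+ n = pi *+ 2 by rewrite -[LHS]mulr_natr divfK// gt_eqF.
pose F k := if bad k then `[h *+ k, h *+ k.+1]%classic else set0.
have cover : `[0, pi *+ 2]%classic `<=` E `|` \big[setU/set0]_(k < n) F k.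
  move=> x /= x02; have [Ex|nEx] := pselect (E x); [by left|right].
  have [k kn /andP[kx xk]] : exists2 k, (k < n)%N & h *+ k <= x <= h *+ k.+1.
    by apply: cells_cover; rewrite // hn; move: x02; rewrite in_itv.
  rewrite -bigcup_mkord; exists k => //; rewrite /F.
  have -> : bad k.
    rewrite /bad (le_trans (pK _ x))//.
    have : normc p.[cis x] <= M * expR (- u).
      by rewrite leNgt; apply/negP => /(EP _ x02).
    (* Since 0 <= t <= h, the grid point and [x] lie in the same cell, of length [h]. *)
    suff : K * `|t + h *+ k - x| <= g by rewrite /g; lra.
    apply: (@le_trans _ _ (K * h)).
      by rewrite ler_wpM2l// ler_norml; move: kx xk; rewrite mulrS; lra.
    by rewrite /h mulrA ler_pdivrMr// [g * _]mulrC -ler_pdivrMr// ltW.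
  by rewrite /= in_itv /= kx.
have := lebesgue_le_cover cover.
rewrite lebesgue_measure_itv /= lte_fin pi2 oppr0 adde0.
have -> : (\sum_(k < n) lebesgue_measure (F k) =
    (h * (\sum_(k < n) bad k)%N%:R)%:E)%E.
  rewrite natr_sum mulr_sumr -sumEFin; apply: eq_bigr => k _; rewrite /F.
  case: ifP => _; last by rewrite measure0 mulr0.
  rewrite lebesgue_measure_itv /= lte_fin mulrS ltrDr h0 -EFinB mulr1.
  by congr (_%:E); rewrite addrK.
move=> le2pi.
rewrite mulrBr mulr1 EFinB leeBlDr//.
apply: (le_trans le2pi); rewrite -addeA leeD2l// -EFinD lee_fin.
rewrite addrC (le_trans _ u'e)//.
rewrite /h mulrAC ler_pdivrMr// -[leRHS]mulrA ler_pM2l// mulrAC ler_pdivlMr//.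
by rewrite [s * _]mulrC.
Qed.

End JensenMeasure.

(** * Conclusion for products of SL(2,R) matrices and rotations *)

Unset Implicit Arguments.

Theorem corollary4 (R : realType) (n : nat) (hn : (1 <= n)%N)
    (A : 'I_n -> 'M[R]_2) (hA : forall j, \det (A j) = 1)
    (a : R) (ha : 0 < a) :
  let E := [set theta : R | theta \in `[0, 2 * pi] /\
    n%:R^-1 * ln (opnorm (rotprod A theta)) >
      - a + n%:R^-1 * \sum_(j < n) ln (opnorm (A j))] in
  ((1 - ln 2 / a)%:E <= circle_measure E)%E.
Proof.
cbv zeta; set E := [set theta | _]; have [p [p0 pA]] := rotprod_poly A.
have n0 : 0 < n%:R :> R by rewrite ltr0n.
pose S := \sum_(j < n) ln (opnorm (A j)).
have SE : expR S = \prod_(j < n) opnorm (A j).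
  rewrite expR_sum; apply: eq_bigr => j _.
  by rewrite lnK// posrE opnorm_gt0.
have pi2 : 2 * pi = pi *+ 2 :> R by rewrite mulr_natl.
have pi2_gt0 : 0 < pi *+ 2 :> R by rewrite mulrn_wgt0// pi_gt0.
have ln2_ge0 : 0 <= n%:R * ln 2 :> R by rewrite mulr_ge0// ln_ge0// ler1n.
have na_gt0 : 0 < n%:R * a by rewrite mulr_gt0.
have : ((pi *+ 2 * (1 - (n%:R * ln 2) / (n%:R * a)))%:E
    <= lebesgue_measure (E `&` `[0%R, (2 * pi)%R]))%E.
  (* Here M is the product of the norms of the [A j], s = n ln 2 and u = n a. *)
  apply: (@jensen_measure _ p _ _ _ _ (expR_gt0 S) ln2_ge0 na_gt0).
  - by move=> t; rewrite pA SE (le_trans (normc_conformal_le _))// opnorm_rotprod_le.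
  - rewrite p0 SE expRN expRM_natl lnK ?posrE// -exprVn.
    (* The factor e^{-n ln 2} gives one 1/2 to each norm, to be compared with the modulus of the
       conformal part. *)
    rewrite -[in X in _ ^+ X](card_ord n) -prodr_const -big_split /=.
    apply: ler_prod => j _; rewrite mulr_ge0 ?opnorm_ge0 ?invr_ge0//=.
    by rewrite opnorm_le_conformal.
  - move=> t; rewrite pi2 => t02; rewrite -expRD pA => h.
    suff Et : E t by split.
    split; first by rewrite pi2.
    (* The lower bound on |p| passes to the operator norm; the resulting positivity lets [lnK] turn
       it into a bound on the logarithm. *)
    have op := lt_le_trans h (normc_conformal_le _).
    have op0 := lt_trans (expR_gt0 _) op.
    move: op; rewrite -{1}[opnorm _]lnK ?posrE// ltr_expR => op.
    rewrite -/S -(ltr_pM2l n0) mulrDr !mulVKf ?gt_eqF//; lra.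
have -> : n%:R * ln 2 / (n%:R * a) = ln 2 / a by field; rewrite !gt_eqF.
rewrite /circle_measure pi2 EFinM => h.
rewrite -[X in (X <= _)%E]mul1e -[X in (X%:E * _ <= _)%E](mulVf (lt0r_neq0 pi2_gt0)).
by rewrite EFinM -muleA lee_pmul2l// lte_fin invr_gt0.
Qed.
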